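(* Let $(V,R)=\bigoplus_{s=1}^k (V_s,R_{\varphi_s})$, where each $\varphi_s$ is a nondegenerate symmetric bilinear form on $V_s$. Let $A\in G_R$, let $i,j\in\{1,\dots,k\}$, and let $(p_s,q_s)$ be the signature of $\varphi_s$ for $s=i,j$. (1) If $A(V_i)\subseteq V_j$, then $\dim(V_i)=\dim(V_j)$. (2) If $A(V_i)\subseteq V_j$ and $\mathrm{Rank}(\varphi_i)\ge 2$, then $(p_i,q_i)=(p_j,q_j)$ or $(p_i,q_i)=(q_j,p_j)$. (3) If $(p_i,q_i)=(p_j,q_j)$ or $(p_i,q_i)=(q_j,p_j)$, then there exists $B\in G_R$ with $B(V_i)\subseteq V_j$. In this event, one must have $(B|_{V_i})^*R_{\varphi_j}=R_{\varphi_i}$.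
   Context: All vector spaces are real and finite-dimensional. An algebraic curvature tensor on $V$ is a 4-linear form $R:V^4\to\mathbb{R}$ with $R(x,y,z,w)=-R(y,x,z,w)$, $R(x,y,z,w)=R(z,w,x,y)$ and $R(x,y,z,w)+R(x,z,w,y)+R(x,w,y,z)=0$. For a symmetric bilinear form $\varphi$, $R_\varphi(x,y,z,w)=\varphi(x,w)\varphi(y,z)-\varphi(x,z)\varphi(y,w)$. Writing $(V,R)=\bigoplus_{s=1}^k (V_s,R_s)$ means: $R$ is an algebraic curvature tensor on $V$, $V=V_1\oplus\cdots\oplus V_k$ with $\dim V_s\ge 1$, $R(x,y,z,w)=0$ for all $z,w\in V$ whenever $x\in V_a$, $y\in V_b$ with $a\neq b$, and the restriction of $R$ to $V_s$ is $R_s$. (Equivalently $R(x,y,z,w)=\sum_s R_s(x_s,y_s,z_s,w_s)$, where $x_s$ denotes the $V_s$-component of $x$, etc.) $G_R=\{A\in GL(V): R(Ax,Ay,Az,Aw)=R(x,y,z,w)\ \text{for all } x,y,z,w\in V\}$. For a linear map $B:U\to U'$ and a 4-linear form $T$ on $U'$, $(B^*T)(x,y,z,w)=T(Bx,By,Bz,Bw)$. Signature $(p,q)$ means that an orthonormal basis has $p$ vectors with $\varphi(e,e)=-1$ and $q$ vectors with $\varphi(e,e)=+1$. *)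

(* Defs.v *)
From HB Require Import structures.
From mathcomp Require Import all_boot all_order all_algebra.
From mathcomp Require Import sesquilinear reals.

Set Implicit Arguments.
Unset Strict Implicit.
Unset Printing Implicit Defensive.

Import Order.TTheory GRing.Theory Num.Theory.
Local Open Scope ring_scope.

Section CurvatureTensors.
Variable R : realType.

Definition form4 (U : vectType R) := U -> U -> U -> U -> R.

Definition form4_linear (U : vectType R) (T : form4 U) : Prop :=
  [/\ forall y z w, scalar (fun x => T x y z w),
      forall x z w, scalar (fun y => T x y z w),
      forall x y w, scalar (fun z => T x y z w)
    & forall x y z, scalar (fun w => T x y z w)].

Definition curvature_tensor (U : vectType R) (T : form4 U) : Prop :=
  [/\ form4_linear T,
      forall x y z w, T x y z w = - T y x z w,
      forall x y z w, T x y z w = T z w x y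
    & forall x y z w, T x y z w + T x z w y + T x w y z = 0].

Definition canonical_tensor (U : vectType R) (phi : {symmetric U}) : form4 U :=
  fun x y z w => phi x w * phi y z - phi x z * phi y w.

Definition pullback (U U' : vectType R) (B : U -> U') (T : form4 U') : form4 U :=
  fun x y z w => T (B x) (B y) (B z) (B w).

Definition form_rank (U : vectType R) (phi : {symmetric U}) : nat :=
  let b := vbasis {:U} in
  \rank (\matrix_(a < \dim {:U}, c < \dim {:U}) phi b`_a b`_c).

Definition has_signature (U : vectType R) (phi : {symmetric U}) (p q : nat) :
    Prop :=
  exists e : seq U,
    [/\ basis_of {:U} e,
        pairwise_orthogonal phi e,
        all (fun v => (phi v v == -1) || (phi v v == 1)) e,
        count (fun v => phi v v == -1) e = p
      & count (fun v => phi v v == 1) e = q].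

Section Decomposition.
Variable V : vectType R.

Definition curvature_decomposition (T : form4 V) (k : nat)
    (Vs : 'I_k -> {vspace V}) (Ts : forall s, form4 (subvs_of (Vs s))) : Prop :=
  [/\ curvature_tensor T,
      directv (\sum_(s < k) Vs s)%VS /\ (\sum_(s < k) Vs s)%VS = fullv,
      forall s, (1 <= \dim (Vs s))%N,
      forall a b, a != b -> forall x y z w,
        x \in Vs a -> y \in Vs b -> T x y z w = 0
    & forall s x y z w, pullback (@vsval R V (Vs s)) T x y z w = Ts s x y z w].

Definition structure_group (T : form4 V) (A : 'End(V)) : Prop :=
  bijective A /\ forall x y z w, T (A x) (A y) (A z) (A w) = T x y z w.

(* The map U -> W induced by B; vsproj is only the corestriction to W, hence
   this is meaningful only when B maps U into W. *)
Definition restrict_to (U W : {vspace V}) (B : 'End(V)) :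
    subvs_of U -> subvs_of W :=
  fun x => vsproj W (B (vsval x)).

End Decomposition.
End CurvatureTensors.

(* Main.v *)
Require Import Defs.
From HB Require Import structures.
From mathcomp Require Import all_boot all_order all_algebra.
From mathcomp Require Import sesquilinear reals.
From mathcomp Require Import perm ring lra zify.
Set Implicit Arguments.
Unset Strict Implicit.
Unset Printing Implicit Defensive.
Import Order.TTheory GRing.Theory Num.Theory.
Local Open Scope ring_scope.

(** By the symmetries and the Bianchi identity, the tensor is the sum of its
    restrictions to the summands ([tensor_components]).

    Dimensions.  For a nondegenerate [phi], the tensor of [phi] vanishes on
    [x, y] only when [x] and [y] are proportional ([canonical_tensor_kernel]).
    Let [A] map [Vs i] into [Vs j].  The images of the other summands pair
    trivially with [A @: Vs i], so their components along [Vs j] are proportional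
    to all of its vectors.  If [Vs i] has dimension at least two they are
    therefore zero, and [A @: Vs i] fills [Vs j].  If [Vs i] is a line, it is in
    the kernel of the tensor, hence so is its image, and [Vs j] must be a line
    as well ([structure_group_image]).

    Signatures.  [A] then restricts to an isomorphism that carries the canonical
    tensor of [phi i] to that of [phi j].  In dimension at least three a canonical
    tensor determines its form up to sign ([curvature_frame_diagonal]).  In
    dimension two it determines the sign of the Gram determinant
    ([gram_det_change_of_basis]).  Either way the law of inertia
    ([sylvester_inertia]) gives equality of the signatures up to exchange
    ([curvature_isometry_signature]).

    Converse.  When the signatures agree up to exchange, frames can be matched so
    that a linear bijection carries one form to plus or minus the other.  Such a
    map preserves canonical tensors ([curvature_isometry_exists]), and exchanging
    the two summands through it gives an element of the structure group
    ([structure_group_swap]). *)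

(** * Orthonormal frames of a symmetric form *)

Section Forms.
Variables (R : realType) (U : vectType R) (phi : {symmetric U}).
Implicit Types (e f : seq U) (x y z v : U).

Lemma symmetric_formC x y : phi x y = phi y x.
Proof. by rewrite hermC expr0 mul1r. Qed.

Lemma nondegenerate_eq0 x :
  nondegenerate phi -> (forall z, phi x z = 0) -> x = 0.
Proof.
move=> /eqP rad0 x0; apply/eqP; rewrite -memv0 -rad0.
by apply/mem_orthovP => v _; apply: x0.
Qed.

Lemma nondegenerate_eq0_basis e x :
  nondegenerate phi -> basis_of fullv e -> {in e, forall z, phi x z = 0} ->
  x = 0.
Proof.
move=> nd be x0; apply: nondegenerate_eq0 => // z.
have /(free_span (basis_free be))[k -> _] : z \in <<e>>%VS.
  by rewrite (span_basis be) memvf.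
rewrite linear_sumr big_seq big1 // => t te.
by rewrite linearZr_LR /= x0 // mulr0.
Qed.

(** Vanishing of the tensor says that [phi x] and [phi y] are proportional as
    linear functionals, and nondegeneracy makes [phi] injective. *)
Lemma canonical_tensor_kernel x y :
  nondegenerate phi -> x != 0 ->
  (forall z w, canonical_tensor phi x y z w = 0) -> y \in <[x]>%VS.
Proof.
move=> nd x0 h.
have /mem_orthovPn[u _ xu] : x \notin orthov phi fullv by rewrite (eqP nd) memv0.
have : phi x u *: y - phi y u *: x = 0.
  apply: nondegenerate_eq0 => // z; rewrite linearBl !linearZl_LR /=.
  have := h z u; rewrite /canonical_tensor; lra.
move/eqP; rewrite subr_eq0 => /eqP e.
apply/vlineP; exists ((phi x u)^-1 * phi y u).
by rewrite -scalerA -e scalerA mulVf ?scale1r.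
Qed.

Lemma form_orthogonal_sum e (k : U -> R) : uniq e ->
  {in e &, forall x y, x != y -> phi x y = 0} ->
  phi (\sum_(x <- e) k x *: x) (\sum_(x <- e) k x *: x)
  = \sum_(x <- e) k x ^+ 2 * phi x x.
Proof.
move=> ue oe; rewrite linear_sumlz; apply: eq_big_seq => x xe.
rewrite linear_sumr (bigD1_seq x) //= big_seq_cond big1 ?addr0 => [|y].
  by rewrite linearZl_LR linearZr_LR /= mulrA.
case/andP=> ye yx; rewrite linearZl_LR linearZr_LR /= oe 1?eq_sym //.
by rewrite !mulr0.
Qed.

(** Orthogonality and the values on the diagonal are stated through membership,
    so that a frame can be reordered freely. *)
Definition orthonormal_frame e : Prop :=
  [/\ basis_of fullv e,
      {in e &, forall x y, x != y -> phi x y = 0}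
    & {in e, forall x, phi x x = -1 \/ phi x x = 1}].

Definition negative_count e := count (fun v => phi v v == -1) e.
Definition positive_count e := count (fun v => phi v v == 1) e.

Lemma eqN11F : ((-1 : R) == 1) = false.
Proof. by apply/eqP => h; have : (0:R) < 1 by []; lra. Qed.

Lemma has_signature_frame p q : has_signature phi p q ->
  exists e, [/\ orthonormal_frame e, negative_count e = p
             & positive_count e = q].
Proof.
case=> e [be /andP[_ po] /allP ae ep eq]; exists e; split=> //; split=> //.
  elim: (e) po => // x s IH /= /andP[/andP[/allP xs _] {}/IH os] y z.
  rewrite !inE => /predU1P[->|ys] /predU1P[->|zs] yz //.
  - by rewrite eqxx in yz.
  - exact/eqP/xs.
  - by rewrite symmetric_formC; apply/eqP/xs.
  - exact: os.
by move=> x /ae /orP[] /eqP ->; [left|right].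
Qed.

Lemma size_full_basis e : basis_of fullv e -> size e = \dim {:U}.
Proof. by move=> be; rewrite (size_basis (X := in_tuple e) be). Qed.

Lemma frame_count e : orthonormal_frame e ->
  (negative_count e + positive_count e)%N = \dim {:U}.
Proof.
case=> be _ ne; rewrite -(size_full_basis be).
rewrite -(count_predC (fun v => phi v v == -1)); congr addn.
apply: eq_in_count => x /ne /= [] ->; first by rewrite eqxx eqN11F.
by rewrite eqxx eq_sym eqN11F.
Qed.

(** Restricted to the span of the negative vectors of one frame the form is
    negative definite, and it is nonnegative on the span of the other vectors of
    a second frame. The two spans meet in zero, so their dimensions add up to at
    most the dimension of the space. *)
Lemma negative_count_le e f :
  orthonormal_frame e -> orthonormal_frame f ->
  (negative_count e <= negative_count f)%N.
Proof.
move=> [be oe ne] [bf of_ nf].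
pose neg := [pred v : U | phi v v == -1].
pose X := filter neg e; pose Y := filter (predC neg) f.
have fX : free X by apply: filter_free; apply: basis_free be.
have fY : free Y by apply: filter_free; apply: basis_free bf.
have subX x : x \in X -> (phi x x == -1) && (x \in e) by rewrite mem_filter.
have subY x : x \in Y -> phi x x = 1 /\ x \in f.
  rewrite mem_filter => /andP[/= nx xf]; split=> //.
  by case: (nf x xf) nx => // ->; rewrite eqxx.
have XY0 : (<<X>> :&: <<Y>> = 0)%VS.
  apply/eqP; rewrite -subv0; apply/subvP => v; rewrite memv_cap memv0.
  case/andP=> /(free_span fX)[k vk _] /(free_span fY)[l vl _].
  have sX : phi v v = - \sum_(x <- X) k x ^+ 2.
    rewrite vk form_orthogonal_sum ?free_uniq //; last first.
      by move=> x y /subX/andP[_ xe] /subX/andP[_ ye]; apply: oe.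
    rewrite -sumrN; apply: eq_big_seq => x /subX/andP[/eqP-> _].
    by rewrite mulrN1.
  have sY : 0 <= phi v v.
    rewrite vl form_orthogonal_sum ?free_uniq //; last first.
      by move=> x y /subY[_ xe] /subY[_ ye]; apply: of_.
    rewrite big_seq sumr_ge0 // => x /subY[-> _].
    by rewrite mulr1 sqr_ge0.
  have : \sum_(x <- X) k x ^+ 2 == 0.
    rewrite eq_le sumr_ge0 ?andbT => [|x _]; last exact: sqr_ge0.
    by rewrite -oppr_ge0 -sX.
  rewrite psumr_eq0 => [/allP k0|x _]; last exact: sqr_ge0.
  rewrite vk big_seq big1 // => x /k0; rewrite sqrf_eq0 => /eqP ->.
  by rewrite scale0r.
have := dimvS (subvf (<<X>> + <<Y>>)%VS).
rewrite (dimv_disjoint_sum XY0).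
move: (fX) (fY); rewrite /free => /eqP -> /eqP ->.
rewrite -(size_full_basis bf) !size_filter.
by rewrite -(count_predC neg f) leq_add2r.
Qed.

(** The number of positive vectors follows from that of the negative ones, since
    the two add up to the dimension. *)
Lemma sylvester_inertia e f :
  orthonormal_frame e -> orthonormal_frame f ->
  negative_count e = negative_count f /\ positive_count e = positive_count f.
Proof.
move=> He Hf.
have n : negative_count e = negative_count f.
  by apply/eqP; rewrite eqn_leq !negative_count_le.
split=> //; apply/eqP.
by rewrite -(eqn_add2l (negative_count e)) {2}n !frame_count.
Qed.

Lemma perm_frame e f : perm_eq e f -> orthonormal_frame e -> orthonormal_frame f.
Proof.
move=> pef [be oe ne]; split; first by rewrite -(perm_basis _ pef).
  by move=> x y; rewrite -!(perm_mem pef); apply: oe.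
by move=> x; rewrite -!(perm_mem pef); apply: ne.
Qed.

(** Grouping the vectors of a frame by sign, in either order, lines up two
    frames of equal or opposite signatures. *)
Lemma frame_sorted e c : orthonormal_frame e -> c = -1 \/ c = 1 ->
  exists2 f, orthonormal_frame f &
    map (fun v => phi v v) f
    = nseq (count (fun v => phi v v == c) e) c
      ++ nseq (count (fun v => phi v v == - c) e) (- c).
Proof.
move=> He Hc; pose P d := [pred v : U | phi v v == d].
have PC : filter (predC (P c)) e = filter (P (- c)) e.
  case: He => _ _ ne; apply: eq_in_filter => x /ne /= [] ->;
    case: Hc => ->; rewrite ?opprK ?eqxx ?(eq_sym 1) ?eqN11F //.
have mapP d : map (fun v => phi v v) (filter (P d) e)
              = nseq (count (P d) e) d.
  rewrite -size_filter -(size_map (fun v => phi v v)); apply/all_pred1P.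
  by apply/allP => _ /mapP[x + ->]; rewrite mem_filter => /andP[].
exists (filter (P c) e ++ filter (P (- c)) e); last by rewrite map_cat !mapP.
by apply: perm_frame He; rewrite -PC perm_sym perm_filterC.
Qed.

Lemma free_notin_span_rem e x : free e -> x \in e -> x \notin <<rem x e>>%VS.
Proof.
move=> fe /perm_to_rem pe; move: fe.
by rewrite (perm_free pe) free_cons => /andP[].
Qed.

Lemma exists_third e x y : uniq e -> (2 < size e)%N ->
  exists2 z, z \in e & (z != x) && (z != y).
Proof.
move=> ue e3; apply/hasP; apply: contraLR e3 => /hasPn no; rewrite -leqNgt.
apply: (uniq_leq_size (s2 := [:: x; y])) => // z /no.
by rewrite !inE negb_and !negbK.
Qed.

(** * Forms with the same canonical tensor *)

(** The hypothesis says that [phi] has, on the basis [e], the curvature of a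
    second form for which [e] is orthonormal with signs [eps].  In dimension at
    least three this determines [phi] up to one global sign [c].  The functional
    [canonical_tensor phi x y y] is [phi y y *: phi x - phi x y *: phi y], and it
    is also a sign times the coordinate along [x].  Comparing two choices [y]
    and [z] in the place of [y] gives a linear relation between the independent
    functionals [phi x], [phi y] and [phi z], in which [phi y] has coefficient
    [phi x y] up to sign; hence [phi x y = 0].  In dimension two no third
    vector is available, and the conclusion can fail. *)
Lemma curvature_frame_diagonal e (eps : U -> R) :
  nondegenerate phi -> basis_of fullv e -> (2 < size e)%N ->
  {in e, forall x, eps x * eps x = 1} ->
  {in e & &, forall x y w, x != y ->
     canonical_tensor phi x y y w = eps x * eps y * (w == x)%:R} ->
  exists2 c : R, c = -1 \/ c = 1 &
    {in e &, forall x y, phi x y = c * eps x * (x == y)%:R}.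
Proof.
move=> nd be e3 eps1 Re.
have fe := basis_free be; have ue := free_uniq fe.
have orth : {in e &, forall x y, x != y -> phi x y = 0}.
  move=> x y xe ye xy; have [z ze /andP[zx zy]] := exists_third x y ue e3.
  (* Through [phi], both terms represent [eps x] times the coordinate along [x]. *)
  have v0 : eps y *: (phi y y *: x - phi x y *: y)
            - eps z *: (phi z z *: x - phi x z *: z) = 0.
    apply: (nondegenerate_eq0_basis nd be) => w we.
    rewrite linearBl !linearZl_LR !linearBl !linearZl_LR /=.
    have := Re x y w xe ye we xy; have := Re x z w xe ze we.
    rewrite eq_sym => /(_ zx); rewrite /canonical_tensor => hz hy.
    rewrite (_ : phi y y * phi x w - phi x y * phi y w
                 = eps x * eps y * (w == x)%:R) -?hy; last by ring.
    rewrite (_ : phi z z * phi x w - phi x z * phi z w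
                 = eps x * eps z * (w == x)%:R) -?hz; last by ring.
    rewrite hy hz; have := eps1 y ye; have := eps1 z ze.
    move=> hz1 hy1.
    by rewrite (mulrC (eps x)) -!mulrA !mulrA hy1 (mulrAC (eps z)) hz1; ring.
  apply/eqP; apply: contraT => pxy.
  have ey0 : eps y * phi x y != 0.
    rewrite mulf_neq0 //; apply/eqP => h.
    by have := eps1 y ye; rewrite h; lra.
  case/negP: (free_notin_span_rem fe ye).
  rewrite -[y in y \in _](scalerK ey0) memvZ // -scalerA.
  have -> : eps y *: (phi x y *: y)
            = eps y *: (phi y y *: x) - eps z *: (phi z z *: x - phi x z *: z).
    by move: v0; rewrite scalerBr addrAC => /eqP; rewrite subr_eq0 => /eqP ->.
  by rewrite rpredB ?memvZ ?memvB ?memvZ // memv_span // mem_rem_uniq //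
    inE ?xe ?ze ?xy ?zy.
have prod1 : {in e &, forall x y, x != y ->
    (phi x x * eps x) * (phi y y * eps y) = 1}.
  move=> x y xe ye xy; have := Re x y x xe ye xe xy.
  rewrite /canonical_tensor (orth x y) // mul0r subr0 eqxx mulr1 => h.
  by rewrite mulrACA h mulrACA eps1 // eps1 // mulr1.
have diag x y : x \in e -> y \in e -> phi x x * eps x = phi y y * eps y.
  move=> xe ye; have [->//|xy] := eqVneq x y.
  have [z ze /andP[zx zy]] := exists_third x y ue e3.
  have := prod1 x z xe ze; have := prod1 y z ye ze.
  rewrite ![_ == z]eq_sym => /(_ zy) hy /(_ zx) hx.
  by rewrite -[LHS]mulr1 -hy mulrCA hx mulr1.
have x0e : nth 0 e 0 \in e by rewrite mem_nth // (leq_trans _ e3).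
move: (nth 0 e 0) x0e => x0 x0e.
exists (phi x0 x0 * eps x0).
  have [z ze /andP[zx _]] := exists_third x0 x0 ue e3.
  have := prod1 _ _ ze x0e zx; rewrite (diag _ _ ze x0e) -expr2.
  by move/eqP; rewrite sqrf_eq1 => /orP[] /eqP; [right|left].
move=> x y xe ye; have [<-|xy] := eqVneq x y; last by rewrite orth // mulr0.
by rewrite (diag x0 x) // mulr1 -mulrA eps1 // mulr1.
Qed.

(** In dimension two the only independent value of the tensor is the Gram
    determinant, which a change of basis multiplies by the square of its
    determinant [d]; its sign is thus an invariant of the form. *)
Lemma gram_det_change_of_basis e f : orthonormal_frame f -> \dim {:U} = 2 ->
  size e = 2 ->
  let g := fun s => canonical_tensor phi s`_0 s`_1 s`_1 s`_0 in
  exists d, g e = d ^+ 2 * g f.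
Proof.
case=> bf of_ nf d2 e2 g.
move: bf of_ (basis_free bf) (size_full_basis bf).
rewrite d2 {}/g; case: f nf => [|u [|v []]] // nf bf of_ ff _.
case: e e2 => [|x [|y []]] // _ /=.
have uv : phi u v = 0.
  apply: of_; rewrite ?inE ?eqxx ?orbT //.
  by move: (free_uniq ff); rewrite /= inE andbT.
have sp z : exists a b, z = a *: u + b *: v.
  have /(free_span ff)[k -> _] : z \in <<[:: u; v]>>%VS.
    by rewrite (span_basis bf) memvf.
  by exists (k u), (k v); rewrite !big_cons big_nil addr0.
have [a [b ->]] := sp x; have [c [d ->]] := sp y.
exists (a * d - b * c); rewrite /canonical_tensor.
rewrite !(linearDl, linearDr) !(linearZl_LR, linearZr_LR) /=.
rewrite (symmetric_formC v u) uv; ring.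
Qed.

Lemma frame_gram_det e : orthonormal_frame e -> size e = 2 ->
  canonical_tensor phi e`_0 e`_1 e`_1 e`_0 = (-1) ^+ negative_count e.
Proof.
case=> be oe ne; move: ne oe (basis_free be); case: e be => [|x [|y []]] // be.
move=> ne oe /free_uniq; rewrite /= inE andbT => xy _.
rewrite /canonical_tensor (oe x y) ?inE ?eqxx ?orbT // mul0r subr0.
rewrite /negative_count /=.
have xe : x \in [:: x; y] by rewrite inE eqxx.
have ye : y \in [:: x; y] by rewrite !inE eqxx orbT.
by case: (ne x xe) => ->; case: (ne y ye) => ->;
   rewrite ?(eq_sym 1) ?eqN11F ?eqxx /= ?expr0 ?expr1 ?expr2 ?mulr1 ?mul1r.
Qed.
End Forms.

(** * Linear maps that preserve canonical tensors *)

Section Isometries.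
Variables (R : realType) (U U' : vectType R).
Variables (phi : {symmetric U}) (phi' : {symmetric U'}).

(** The image of a frame of [phi] is a basis on which [phi'] has the curvature
    prescribed by the signs of that frame.  From dimension three on it is
    therefore a frame of [phi'] with equal or opposite signs, and the law of
    inertia applies.  In dimension two only the sign of the Gram determinant is
    preserved, that is the parity of the number of negative vectors; among the
    signatures (0,2), (1,1) and (2,0) this suffices. *)
Lemma curvature_isometry_signature (L : 'Hom(U, U')) p q p' q' :
  nondegenerate phi' -> bijective L -> (1 < \dim {:U})%N ->
  (forall x y z w, pullback L (canonical_tensor phi') x y z w
                   = canonical_tensor phi x y z w) ->
  has_signature phi p q -> has_signature phi' p' q' ->
  (p, q) = (p', q') \/ (p, q) = (q', p').
Proof.
move=> nd [L' LK L'K] d2 iso /has_signature_frame[e [Fe <- <-]].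
move=> /has_signature_frame[f [Ff <- <-]].
have [be oe ne] := Fe.
have injL : injective L by apply: can_inj LK.
have kerL : lker L == 0%VS by apply/lker0P.
have limgL : limg L = fullv.
  apply/eqP; rewrite eqEsubv subvf /=; apply/subvP => v _.
  by rewrite -(L'K v) memv_img ?memvf.
have bLe : basis_of fullv (map L e).
  by rewrite -limgL limg_basis_of // (eqP kerL) capv0.
have szL : size (map L e) = \dim {:U'} := size_full_basis bLe.
have sze : size e = \dim {:U} := size_full_basis be.
have tensor x y w : x \in e -> y \in e -> w \in e -> x != y ->
    canonical_tensor phi' (L x) (L y) (L y) (L w)
    = phi x x * phi y y * (w == x)%:R.
  move=> xe ye we xy; have := iso x y y w; rewrite /pullback => ->.
  rewrite /canonical_tensor (oe x y) // mul0r subr0.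
  have [->|wx] := eqVneq w x; first by rewrite mulr1.
  by rewrite (oe x w) 1?eq_sym // mul0r mulr0.
have [d3|d3] := ltnP 2 (\dim {:U}).
  pose eps v := phi (L' v) (L' v).
  have [|||c c1 diag] := @curvature_frame_diagonal _ _ phi' (map L e) eps nd bLe.
  - by rewrite size_map sze.
  - move=> _ /mapP[x xe ->]; rewrite /eps LK.
    by case: (ne x xe) => ->; rewrite ?mulrNN mulr1.
  - move=> _ _ _ /mapP[x xe ->] /mapP[y ye ->] /mapP[w we ->].
    by rewrite !(inj_eq injL) /eps !LK => xy; apply: tensor.
  have diagL x : x \in e -> phi' (L x) (L x) = c * phi x x.
    by move=> xe; rewrite diag ?map_f // eqxx mulr1 /eps LK.
  have FL : orthonormal_frame phi' (map L e).
    split=> //.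
      by move=> x y xe ye /negbTE xy; rewrite diag // xy mulr0.
    move=> _ /mapP[x xe ->]; rewrite diagL //.
    case: c1 (ne x xe) => -> [] ->; rewrite ?mulrNN ?mulr1 ?mul1r; auto.
  have [<- <-] := sylvester_inertia FL Ff.
  rewrite /negative_count /positive_count !count_map.
  case: c1 diagL => -> diagL; [right|left];
    congr pair; apply: eq_in_count => x xe /=; rewrite diagL //.
  - by rewrite mulN1r eqr_oppLR.
  - by rewrite mulN1r eqr_oppLR opprK.
  - by rewrite mul1r.
  - by rewrite mul1r.
have d2e : \dim {:U} = 2 by apply/eqP; rewrite eqn_leq d3 d2.
have e2 : size e = 2 by rewrite sze.
have d2' : \dim {:U'} = 2 by rewrite -szL size_map.
have f2 : size f = 2 by case: Ff => /size_full_basis ->.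
have [|d] := gram_det_change_of_basis (phi := phi') (e := map L e) Ff d2'.
  by rewrite size_map.
rewrite !(nth_map 0) ?e2 //.
have := iso e`_0 e`_1 e`_1 e`_0; rewrite /pullback => ->.
rewrite !frame_gram_det // => sgn.
have par : odd (negative_count phi e) = odd (negative_count phi' f).
  move: sgn; rewrite -[LHS]signr_odd -[X in _ * X]signr_odd.
  by have := sqr_ge0 d; do 2!case: odd; rewrite ?expr0 ?expr1 //; lra.
have := frame_count Fe; have := frame_count Ff; rewrite d2e d2' => cf ce.
have [[-> ->]|[-> ->]] :
    negative_count phi e = negative_count phi' f
    /\ positive_count phi e = positive_count phi' f
    \/ negative_count phi e = positive_count phi' f
    /\ positive_count phi e = negative_count phi' f by lia.
  by left.
by right.
Qed.

(** Sorting one frame by increasing and the other by increasing or decreasing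
    sign, according to whether the signatures agree or are swapped, gives a
    linear bijection that carries one form to plus or minus the other; the
    canonical tensor, being quadratic in the form, does not see the sign. *)
Lemma curvature_isometry_exists p q p' q' :
  has_signature phi p q -> has_signature phi' p' q' ->
  (p, q) = (p', q') \/ (p, q) = (q', p') ->
  exists (L : 'Hom(U, U')) (L' : 'Hom(U', U)),
    [/\ cancel L L', cancel L' L
      & forall x y z w, pullback L (canonical_tensor phi') x y z w
                        = canonical_tensor phi x y z w].
Proof.
move=> /has_signature_frame[e0 [Fe0 ne0 pe0]].
move=> /has_signature_frame[f0 [Ff0 nf0 pf0]] sgn.
have [c [c1 [e [f [Fe Ff ef]]]]] : exists c : R, [/\ c = -1 \/ c = 1 & 
    exists e f, [/\ orthonormal_frame phi e, orthonormal_frame phi' f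
      & map (fun v => phi' v v) f = map (fun v => c * phi v v) e]].
  have [e Fe se] := frame_sorted Fe0 (or_introl erefl).
  have sc c : map (fun v => c * phi v v) e = map ( *%R c) (map (fun v => phi v v) e).
    by rewrite -map_comp.
  case: sgn => -[Ep Eq]; [exists 1|exists (-1)]; split; auto; exists e.
    have [f Ff sf] := frame_sorted Ff0 (or_introl erefl).
    exists f; split=> //; rewrite sc se sf map_cat !map_nseq !mul1r.
    rewrite opprK -/(negative_count _ _) -/(negative_count _ _).
    rewrite -/(positive_count _ _) -/(positive_count _ _).
    by rewrite ne0 nf0 pe0 pf0 Ep Eq.
  have [f Ff sf] := frame_sorted Ff0 (or_intror erefl).
  exists f; split=> //; rewrite sc se sf map_cat !map_nseq !mulN1r.
  rewrite !opprK -/(negative_count _ _) -/(negative_count _ _).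
  rewrite -/(positive_count _ _) -/(positive_count _ _).
  by rewrite ne0 nf0 pe0 pf0 Ep Eq.
have [be oe _] := Fe; have [bf of_ _] := Ff.
have szef : size f = size e by rewrite -(size_map (fun v => phi' v v)) ef size_map.
have [L0 /(_ (basis_free be) szef) L0e] := linear_of_free e f.
pose L : 'Hom(U, U') := linfun L0.
have Le : map L e = f by rewrite -L0e; apply: eq_map => v; rewrite lfunE.
have limgL : limg L = fullv by rewrite -(span_basis be) limg_span Le (span_basis bf).
have kerL : lker L == 0%VS.
  rewrite -dimv_eq0 -(eqn_add2r (\dim (limg L))) add0n.
  rewrite -[X in (\dim X + _)%N]capfv limg_ker_dim limgL.
  by rewrite -(size_full_basis be) -(size_full_basis bf) szef.
have injL : injective L by apply/lker0P.
exists L, (L^-1)%VF; split; first exact: lker0_lfunK.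
  by move=> v; rewrite limg_lfunVK // limgL memvf.
have Lbase x y : x \in e -> y \in e -> phi' (L x) (L y) = c * phi x y.
  move=> xe ye; have [<-|xy] := eqVneq x y; last first.
    by rewrite oe // mulr0 of_ -?Le ?map_f // (inj_eq injL).
  move: ef; rewrite -Le -map_comp => /eq_in_map; exact.
have Lform x y : phi' (L x) (L y) = c * phi x y.
  have sp z : exists k, z = \sum_(x <- e) k x *: x.
    have /(free_span (basis_free be))[k -> _] : z \in <<e>>%VS.
      by rewrite (span_basis be) memvf.
    by exists k.
  have [k ->] := sp x; have [l ->] := sp y.
  rewrite !(linear_sum L) !linear_sumlz mulr_sumr; apply: eq_big_seq => u ue.
  rewrite !linear_sumr mulr_sumr; apply: eq_big_seq => v ve.
  rewrite !(linearZ_LR L) /= !(linearZl_LR, linearZr_LR) /= Lbase //; ring.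
move=> x y z w; rewrite /pullback /canonical_tensor !Lform.
by case: c1 => ->; ring.
Qed.

End Isometries.

(** * Direct sums of curvature tensors *)

Lemma scalar_zero (R : realType) (U : vectType R) (f : U -> R) :
  scalar f -> f 0 = 0.
Proof. by move=> lf; have := lf (-1) 0 0; rewrite scaler0 addr0; lra. Qed.

Lemma scalar_sum (R : realType) (U : vectType R) (f : U -> R) (I : Type)
    (r : seq I) (P : pred I) (F : I -> U) :
  scalar f -> f (\sum_(i <- r | P i) F i) = \sum_(i <- r | P i) f (F i).
Proof.
move=> lf; apply: (big_morph f); last exact: scalar_zero.
by move=> x y; have := lf 1 x y; rewrite scale1r mul1r.
Qed.

Section Components.
Variables (R : realType) (V : vectType R) (k : nat) (Vs : 'I_k -> {vspace V}).
Hypothesis direct : directv (\sum_(s < k) Vs s).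
Hypothesis total : (\sum_(s < k) Vs s)%VS = fullv.

Definition component (s : 'I_k) : 'End(V) := sumv_pi_for (esym total) s.

Lemma component_mem s v : component s v \in Vs s.
Proof. exact: memv_sum_pi. Qed.

Lemma component_sum v : \sum_(s < k) component s v = v.
Proof. by apply: sumv_pi_sum; rewrite ?memvf. Qed.

Lemma component_unique (u : 'I_k -> V) s :
  (forall t, u t \in Vs t) -> component s (\sum_t u t) = u s.
Proof.
move=> uV; have /directv_sum_unique d := direct.
have := d (fun t => component t (\sum_t u t)) u
          (fun t _ => component_mem t _) (fun t _ => uV t).
by rewrite component_sum eqxx => /esym/forall_inP/(_ s isT)/eqP.
Qed.

Lemma component_in s t v :
  v \in Vs s -> component t v = if t == s then v else 0.
Proof.
move=> vs; rewrite -(@component_unique (fun t => if t == s then v else 0)).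
  by rewrite -big_mkcond big_pred1_eq.
by move=> r; case: eqP => [->|_] //; rewrite mem0v.
Qed.

Section Tensor.
Variable T : form4 V.
Hypothesis curvT : curvature_tensor T.
Hypothesis crossT : forall a b, a != b -> forall x y z w,
  x \in Vs a -> y \in Vs b -> T x y z w = 0.

(** The hypothesis only concerns the first two arguments. Pair symmetry moves
    it to the last two, and the Bianchi identity then kills every value whose
    first two arguments lie in one summand and whose third lies in another. *)
Lemma tensor_components x y z w :
  T x y z w = \sum_(s < k) T (component s x) (component s y)
                             (component s z) (component s w).
Proof.
have [[l1 l2 l3 l4] _ pair bianchi] := curvT.
have cross3 a b u v t r : a != b -> u \in Vs a -> v \in Vs a -> t \in Vs b ->
    T u v t r = 0.
  move=> ab ua va tb; have := bianchi u v t r.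
  rewrite (crossT ab _ _ ua tb) (pair u r v t) (crossT ab _ _ va tb).
  by rewrite !addr0.
have cross34 a b u v t r : a != b -> t \in Vs a -> r \in Vs b -> T u v t r = 0.
  by move=> ab ta rb; rewrite pair (crossT ab).
rewrite -[in LHS](component_sum x) (scalar_sum _ _ _ (l1 _ _ _)).
apply: eq_bigr => s _.
have xs := component_mem s x.
rewrite -[in LHS](component_sum y) (scalar_sum _ _ _ (l2 _ _ _)).
rewrite (bigD1 s) //= big1 ?addr0 => [|t ts]; last first.
  by apply: crossT xs (component_mem t y); rewrite eq_sym.
have ys := component_mem s y.
rewrite -[in LHS](component_sum z) (scalar_sum _ _ _ (l3 _ _ _)).
rewrite (bigD1 s) //= big1 ?addr0 => [|t ts]; last first.
  by apply: cross3 xs ys (component_mem t z); rewrite eq_sym.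
rewrite -[in LHS](component_sum w) (scalar_sum _ _ _ (l4 _ _ _)).
rewrite (bigD1 s) //= big1 ?addr0 // => t ts.
by apply: cross34 (component_mem s z) (component_mem t w); rewrite eq_sym.
Qed.

Lemma tensor_component_left s x y z w : x \in Vs s ->
  T x y z w = T x (component s y) (component s z) (component s w).
Proof.
move=> xs; have [[l1 _ _ _] _ _ _] := curvT.
rewrite tensor_components (bigD1 s) //= big1 ?addr0 => [|t ts].
  by rewrite (component_in _ xs) eqxx.
by rewrite (component_in _ xs) (negbTE ts) (scalar_zero (l1 _ _ _)).
Qed.

(** One-dimensional summands lie in the kernel, by antisymmetry. *)
Lemma tensor_line s x y z w : (\dim (Vs s) <= 1)%N -> x \in Vs s ->
  T x y z w = 0.
Proof.
move=> d1 xs; rewrite (tensor_component_left _ _ _ xs).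
have [[l1 l2 _ _] anti _ _] := curvT.
have [->|x0] := eqVneq x 0; first exact: (scalar_zero (l1 _ _ _)).
have : (Vs s <= <[x]>)%VS.
  have xV : (<[x]> <= Vs s)%VS by rewrite -memvE.
  by rewrite -(geq_leqif (dimv_leqif_sup xV)) dim_vline x0.
move/subvP/(_ _ (component_mem s y))/vlineP => [c ->].
have Tx t r : T x x t r = 0 by have := anti x x t r; lra.
have := l2 x (component s z) (component s w) c x 0.
by rewrite addr0 (scalar_zero (l2 _ _ _)) Tx mulr0 addr0.
Qed.

(** Maps between matching summands glue to an element of the structure group,
    because [T] is the sum of its restrictions. *)
Lemma structure_group_glue (sigma : 'I_k -> 'I_k) (beta : 'I_k -> 'End(V)) :
  involutive sigma ->
  (forall s v, v \in Vs s -> beta s v \in Vs (sigma s)) ->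
  (forall s v, v \in Vs s -> beta (sigma s) (beta s v) = v) ->
  (forall s x y z w, x \in Vs s -> y \in Vs s -> z \in Vs s -> w \in Vs s ->
     T (beta s x) (beta s y) (beta s z) (beta s w) = T x y z w) ->
  exists2 B : 'End(V), structure_group T B
    & forall s v, v \in Vs s -> B v = beta s v.
Proof.
move=> sigmaK betaV betaK isobeta.
pose B := (\sum_s (beta s \o component s))%VF.
have BE v : B v = \sum_s beta s (component s v).
  by rewrite sum_lfunE; apply: eq_bigr => s _; rewrite comp_lfunE.
have compB s v : component (sigma s) (B v) = beta s (component s v).
  rewrite BE (reindex_inj (inv_inj sigmaK)) /=.
  rewrite (component_unique (u := fun t => beta (sigma t) (component (sigma t) v))).
    by rewrite sigmaK.
  by move=> t; rewrite -[X in Vs X]sigmaK betaV ?component_mem.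
have BK : involutive B.
  move=> v; rewrite BE (reindex_inj (inv_inj sigmaK)) /= -[RHS]component_sum.
  by apply: eq_bigr => s _; rewrite compB betaK ?component_mem.
exists B; first split; first exact: inv_bij.
  move=> x y z w; rewrite tensor_components (reindex_inj (inv_inj sigmaK)) /=.
  rewrite [RHS]tensor_components; apply: eq_bigr => s _.
  by rewrite !compB isobeta ?component_mem.
move=> s v vs; rewrite BE (bigD1 s) //= big1 ?addr0 => [|t ts].
  by rewrite (component_in _ vs) eqxx.
by rewrite (component_in _ vs) (negbTE ts) linear0.
Qed.

Section Blocks.
Variable phi : forall s : 'I_k, {symmetric (subvs_of (Vs s))}.
Hypothesis nd : forall s, nondegenerate (phi s).
Hypothesis blockT : forall s x y z w, pullback (@vsval R V (Vs s)) T x y z w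
                                      = canonical_tensor (phi s) x y z w.

Lemma tensor_block s x y z w :
  x \in Vs s -> y \in Vs s -> z \in Vs s -> w \in Vs s ->
  T x y z w = canonical_tensor (phi s) (vsproj (Vs s) x) (vsproj (Vs s) y)
                                       (vsproj (Vs s) z) (vsproj (Vs s) w).
Proof. by move=> xs ys zs ws; rewrite -blockT /pullback !vsprojK. Qed.

Lemma tensor_kernel s x v : x \in Vs s -> x != 0 ->
  (forall z w, T x v z w = 0) -> component s v \in <[x]>%VS.
Proof.
move=> xs x0 Txv.
have : vsproj (Vs s) (component s v) \in <[vsproj (Vs s) x]>%VS.
  apply: canonical_tensor_kernel => [||z w]; first exact: nd.
    by apply: contraNneq x0 => h; rewrite -(vsprojK xs) h.
  rewrite -{1}(vsvalK z) -{1}(vsvalK w) -tensor_block ?subvsP ?component_mem //.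
  have := Txv (vsval z) (vsval w); rewrite (tensor_component_left _ _ _ xs).
  by rewrite !(component_in _ (subvsP _)) eqxx.
case/vlineP => c /(congr1 vsval); rewrite linearZ /= !vsprojK ?component_mem //.
by move=> ->; rewrite memvZ // memv_line.
Qed.

(** * Elements of the structure group that map one summand into another *)

(** If [A] maps [Vs i] into [Vs j], the images of the other summands annihilate
    [A @: Vs i], hence their components along [Vs j] are proportional to every
    vector of [A @: Vs i].  When [Vs i] has two independent vectors these
    components vanish, so [A @: Vs i] must fill [Vs j]; when [Vs i] is a line,
    all of [V] annihilates its image, so [Vs j] is that line. *)
Lemma structure_group_image (A : 'End(V)) i j :
  structure_group T A -> (0 < \dim (Vs i))%N -> (A @: Vs i <= Vs j)%VS ->
  (A @: Vs i = Vs j)%VS.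
Proof.
move=> [[A' AK A'K] isoA] di /subvP Aij.
have injA : injective A by apply: can_inj AK.
have A0 x : x != 0 -> A x != 0 by rewrite -{2}(linear0 A) (inj_eq injA).
have AV x : x \in Vs i -> A x \in Vs j by move=> xi; rewrite Aij ?memv_img.
apply/eqP; rewrite eqEsubv; apply/andP; split; first exact/subvP.
have annih x v : x \in Vs i -> x != 0 -> (forall z w, T x v z w = 0) ->
    component j (A v) \in <[A x]>%VS.
  move=> xi x0 Txv; apply: tensor_kernel; rewrite ?AV ?A0 // => z w.
  by rewrite -(A'K z) -(A'K w) isoA.
have [d1|d2] := leqP (\dim (Vs i)) 1.
  pose x := vpick (Vs i).
  have x0 : x != 0 by rewrite vpick0 -dimv_eq0 -lt0n.
  have xi : x \in Vs i := memv_pick _.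
  apply/subvP => v vj.
  suff : v \in <[A x]>%VS by move/vlineP=> [c ->]; rewrite memvZ ?memv_img.
  have := annih x (A' v) xi x0 (fun z w => tensor_line _ _ _ d1 xi).
  by rewrite A'K (component_in _ vj) eqxx.
have other s v : s != i -> v \in Vs s -> component j (A v) = 0.
  move=> si vs; pose b := vbasis (Vs i).
  have [bx by_] : b`_0 \in Vs i /\ b`_1 \in Vs i.
    by split; apply: vbasis_mem; rewrite mem_nth ?size_tuple // ltnW.
  have fb : free b := basis_free (vbasisP _).
  have b0 m : (m < \dim (Vs i))%N -> b`_m != 0.
    by move=> md; apply: free_not0 fb _; rewrite mem_nth ?size_tuple.
  have Tb m z w : b`_m \in Vs i -> T b`_m v z w = 0.
    by move=> bi; apply: crossT bi vs; rewrite eq_sym.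
  have /vlineP[c ec] := annih _ v bx (b0 0 (ltnW d2)) (fun z w => Tb _ z w bx).
  have /vlineP[d ed] := annih _ v by_ (b0 1 d2) (fun z w => Tb _ z w by_).
  have : c *: b`_0 = d *: b`_1 by apply: injA; rewrite !linearZ /= -ec -ed.
  move/(congr1 (coord b (Ordinal (ltnW d2)))); rewrite !linearZ /=.
  rewrite (coord_free (Ordinal (ltnW d2))) // (coord_free (Ordinal d2)) //.
  by rewrite mulr1 mulr0 ec => ->; rewrite scale0r.
apply/subvP => v vj; rewrite -[v](_ : A (component i (A' v)) = v); last first.
  have := component_in j vj; rewrite eqxx -{1}(A'K v).
  rewrite -[A' v in LHS]component_sum !linear_sum (bigD1 i) //= big1 ?addr0.
    by rewrite (component_in j (AV _ (component_mem _ _))) eqxx.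
  by move=> s si; apply: other si (component_mem _ _).
by rewrite memv_img // component_mem.
Qed.

(** Extending [M] to [V] through the inclusions is meaningful only on [Vs a],
    where [vsproj] inverts the inclusion. *)
Definition between_summands a b (M : 'Hom(subvs_of (Vs a), subvs_of (Vs b))) :
    'End(V) :=
  (linfun (@vsval R V (Vs b)) \o (M \o linfun (vsproj (Vs a))))%VF.

Lemma between_summandsE a b (M : 'Hom(subvs_of (Vs a), subvs_of (Vs b))) v :
  between_summands M v = vsval (M (vsproj (Vs a) v)).
Proof. by rewrite !comp_lfunE !lfunE. Qed.

Lemma between_summands_tensor a b (M : 'Hom(subvs_of (Vs a), subvs_of (Vs b)))
    x y z w :
  (forall x y z w, pullback M (canonical_tensor (phi b)) x y z w
                   = canonical_tensor (phi a) x y z w) ->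
  x \in Vs a -> y \in Vs a -> z \in Vs a -> w \in Vs a ->
  T (between_summands M x) (between_summands M y)
    (between_summands M z) (between_summands M w) = T x y z w.
Proof.
move=> isoM xa ya za wa; rewrite !between_summandsE.
by rewrite (@tensor_block b) ?subvsP // !vsvalK (tensor_block xa) // -isoM.
Qed.

(** The isometry of tensors from [Vs i] to [Vs j], its inverse, and the identity
    of the other summands glue along the transposition of [i] and [j]. *)
Lemma structure_group_swap i j p q p' q' :
  has_signature (phi i) p q -> has_signature (phi j) p' q' ->
  (p, q) = (p', q') \/ (p, q) = (q', p') ->
  exists2 B : 'End(V), structure_group T B & (B @: Vs i <= Vs j)%VS.
Proof.
move=> si sj sgn; have [<-|ij] := eqVneq i j.
  exists \1%VF; last by rewrite lim1g.
  by split=> [|x y z w]; [exists id => v; rewrite id_lfunE | rewrite !id_lfunE].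
have [L [L' [LK L'K isoL]]] := curvature_isometry_exists si sj sgn.
have isoL' x y z w : pullback L' (canonical_tensor (phi i)) x y z w
                     = canonical_tensor (phi j) x y z w.
  by rewrite -[LHS]isoL /pullback !L'K.
pose beta s := if s == i then between_summands L
               else if s == j then between_summands L' else \1%VF.
have ji : (j == i) = false by rewrite eq_sym (negbTE ij).
have [|s v|s v|s x y z w|B GB BE] := @structure_group_glue (tperm i j) beta.
- exact: tpermK.
- rewrite /beta; case: tpermP => [->|->|/eqP/negbTE-> /eqP/negbTE->].
  + by rewrite eqxx between_summandsE subvsP.
  + by rewrite ji eqxx between_summandsE subvsP.
  + by rewrite id_lfunE.
- rewrite /beta; case: tpermP => [->|->|/eqP/negbTE-> /eqP/negbTE->] vs.
  + by rewrite eqxx ji eqxx !between_summandsE vsvalK LK vsprojK.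
  + by rewrite eqxx ji eqxx !between_summandsE vsvalK L'K vsprojK.
  + by rewrite !id_lfunE.
- rewrite /beta; have [->|_] := eqVneq s i; first exact: between_summands_tensor.
  have [->|_] := eqVneq s j; first exact: between_summands_tensor.
  by rewrite !id_lfunE.
exists B => //; apply/subvP => _ /memv_imgP[v vi ->].
by rewrite (BE i) // /beta eqxx between_summandsE subvsP.
Qed.

Lemma restrict_tensor (B : 'End(V)) i j (x y z w : subvs_of (Vs i)) :
  structure_group T B -> (B @: Vs i <= Vs j)%VS ->
  pullback (restrict_to (Vs j) B) (canonical_tensor (phi j)) x y z w
  = canonical_tensor (phi i) x y z w.
Proof.
move=> [_ isoB] /subvP Bij.
have BV (u : subvs_of (Vs i)) : B (vsval u) \in Vs j.
  by rewrite Bij // memv_img // subvsP.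
by rewrite -[RHS]blockT /pullback /restrict_to -tensor_block // isoB.
Qed.
End Blocks.
End Tensor.
End Components.

Theorem corollary1p8 (R : realType) (V : vectType R) (T : form4 V)
    (k : nat) (Vs : 'I_k -> {vspace V})
    (phi : forall s : 'I_k, {symmetric (subvs_of (Vs s))})
    (hphi : forall s : 'I_k, nondegenerate (phi s))
    (hT : curvature_decomposition T (fun s => canonical_tensor (phi s)))
    (A : 'End(V)) (hA : structure_group T A)
    (i j : 'I_k) (pi qi pj qj : nat)
    (hi : has_signature (phi i) pi qi) (hj : has_signature (phi j) pj qj) :
  [/\ (A @: Vs i <= Vs j)%VS -> \dim (Vs i) = \dim (Vs j),
      (A @: Vs i <= Vs j)%VS -> (2 <= form_rank (phi i))%N ->
        (pi, qi) = (pj, qj) \/ (pi, qi) = (qj, pj)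
    & (pi, qi) = (pj, qj) \/ (pi, qi) = (qj, pj) ->
        (exists2 B : 'End(V), structure_group T B & (B @: Vs i <= Vs j)%VS)
        /\ (forall B : 'End(V), structure_group T B -> (B @: Vs i <= Vs j)%VS ->
              forall x y z w : subvs_of (Vs i),
                pullback (restrict_to (Vs j) B) (canonical_tensor (phi j))
                  x y z w
                = canonical_tensor (phi i) x y z w)].
Proof.
have [curvT [direct total] dimV crossT blockT] := hT.
have image B : structure_group T B -> (B @: Vs i <= Vs j)%VS ->
    (B @: Vs i = Vs j)%VS.
  by move=> GB; apply: (structure_group_image direct total curvT crossT hphi blockT).
have injA : injective A by case: hA => -[A' AK _] _; apply: can_inj AK.
have restr B : structure_group T B -> (B @: Vs i <= Vs j)%VS -> forall x y z w,
    pullback (restrict_to (Vs j) B) (canonical_tensor (phi j)) x y z w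
    = canonical_tensor (phi i) x y z w.
  by move=> GB Bij x y z w; apply: restrict_tensor.
split.
- move=> /(image _ hA) <-; rewrite limg_dim_eq //.
  by move/lker0P: injA => /eqP ->; rewrite capv0.
- move=> Aij rank2.
  pose L : 'Hom(subvs_of (Vs i), subvs_of (Vs j)) :=
    (linfun (vsproj (Vs j)) \o (A \o linfun (@vsval R V (Vs i))))%VF.
  have LE x : L x = restrict_to (Vs j) A x by rewrite !comp_lfunE !lfunE.
  have AL x : vsval (L x) = A (vsval x).
    by rewrite LE /restrict_to vsprojK // (subvP Aij) ?memv_img ?subvsP.
  apply: (@curvature_isometry_signature _ _ _ (phi i) (phi j) L) hi hj => //.
  + have injL : injective L.
      by move=> x y /(congr1 vsval); rewrite !AL => /injA /val_inj.
    exists (L^-1)%VF; first by apply: lker0_lfunK; apply/lker0P.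
    move=> y; rewrite limg_lfunVK //.
    have /memv_imgP[x xi yx] : vsval y \in (A @: Vs i)%VS.
      by rewrite (image _ hA) // subvsP.
    have -> : y = L (vsproj (Vs i) x) by apply: val_inj; rewrite /= AL vsprojK.
    by rewrite memv_img ?memvf.
  + by apply: leq_trans rank2 _; rewrite /form_rank rank_leq_row.
  + by move=> x y z w; rewrite -(restr A hA Aij) /pullback !LE.
- move=> sgn; split=> //; exact: (structure_group_swap _ _ _ _ blockT hi hj).
Qed.
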